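(* In every $\mathbb{Z}$-spectral system $(m,k,E,J)$, the integer $m$ must be odd.
   Context: A $\mathbb{Z}$-spectral system is a quadruple $(m,k,E,J)$ consisting of integers $m,k\ge2$, an injective function $E:\mathcal{V}\to\mathbb{Z}\smallsetminus\{-1\}$, where $\mathcal{V}=\{1,\dots,2m\}$, and a function $J:\mathcal{V}\to\{0,1\}$, satisfying the following conditions for all $i,i'\in\mathcal{V}$: (a) $k+1=2E(1)$ (and so $k$ must be odd); (b) $E(i)+E(i')=-1$ and $J(i)\ne J(i')$ whenever $i+i'=2m+1$; (c) $E(i)-E(i')=k$ and $J(i)\ne J(i')$ whenever $i'=i+1$ is even; (d) the set $Y=\{-1\}\cup\{E(i):i\in\mathcal{V}\text{ and }J(i)=1\}$ is symmetric about $0$. *)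

(* Defs.v *)
From mathcomp Require Import all_boot all_order all_algebra.

Set Implicit Arguments.
Unset Strict Implicit.
Unset Printing Implicit Defensive.

Import Order.TTheory GRing.Theory Num.Theory.
Local Open Scope ring_scope.

(* The index set {1, ..., 2m} is represented by 'I_(2 * m), the ordinal i
   standing for the index idx i = i + 1. *)
Definition idx (n : nat) (i : 'I_n) : nat := i.+1.

(* J takes its values in {0,1}, encoded as bool with true = 1. *)
Definition spectral_set (m : nat) (E : 'I_(2 * m) -> int)
    (J : 'I_(2 * m) -> bool) (y : int) : Prop :=
  y = -1 \/ exists2 i, J i & y = E i.

Record Z_spectral_system (m : nat) (k : int) (E : 'I_(2 * m) -> int)
    (J : 'I_(2 * m) -> bool) : Prop := ZSpectralSystem {
  zss_m_ge2 : (2 <= m)%N;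
  zss_k_ge2 : 2 <= k;
  zss_E_inj : injective E;
  zss_E_neqN1 : forall i, E i <> -1;
  zss_a : forall i, idx i = 1%N -> k + 1 = 2 * E i;
  zss_b : forall i i', (idx i + idx i' = 2 * m + 1)%N ->
            E i + E i' = -1 /\ J i <> J i';
  zss_c : forall i i', idx i' = (idx i + 1)%N -> ~~ odd (idx i') ->
            E i - E i' = k /\ J i <> J i';
  zss_d : forall y, spectral_set E J y <-> spectral_set E J (- y)
}.

(* Main.v *)
Require Import Defs.
From mathcomp Require Import all_boot all_order all_algebra.
From mathcomp Require Import zify ring.

(** Suppose that [m] is even.  The set [Y] is symmetric about 0, so its elements
    sum to 0, and the [E i] with [J i] sum to 1 ([sum_spectral]).  This
    contradicts parity: composing the two pairings of the index set, the one of
    condition (c) and the one of condition (b), gives an involution [swap_rev]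
    that preserves [J], because each pairing flips it, and for which
    [E i + E (swap_rev i)] is [k - 1] or [- k - 1], which is even since [k] is
    odd.  For even [m] this involution exchanges the lower and upper halves of
    the index set, so that it has no fixed point and the sum of the [E i] with
    [J i] splits into such even pairs. *)

Section Spectral.

Import Order.TTheory GRing.Theory Num.Theory.
Local Open Scope ring_scope.
Local Set Implicit Arguments.
Local Unset Strict Implicit.

Lemma sum_symmetric_seq (s : seq int) :
  uniq s -> (forall y, y \in s -> - y \in s) -> \sum_(y <- s) y = 0.
Proof.
move=> s_uniq s_sym.
have s_opp : perm_eq s [seq - y | y <- s].
  apply: uniq_perm => //; first by rewrite map_inj_uniq //; exact: oppr_inj.
  move=> y; apply/idP/mapP => [ys | [x xs ->]]; last exact: s_sym.
  by exists (- y); rewrite ?opprK //; exact: s_sym.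
have : \sum_(y <- s) y = - \sum_(y <- s) y.
  by rewrite [LHS](perm_big _ s_opp) big_map sumrN.
by lia.
Qed.

Fact swap_subproof (m : nat) (i : 'I_(2 * m)) :
  ((if odd i then i.-1 else i.+1) < 2 * m)%N.
Proof. by have := ltn_ord i; case: ifP; lia. Qed.

(** The pairing of condition (c): ordinals start at 0, so that it matches each
    even ordinal with its successor. *)
Definition swap (m : nat) (i : 'I_(2 * m)) : 'I_(2 * m) :=
  Ordinal (swap_subproof i).

Definition swap_rev (m : nat) (i : 'I_(2 * m)) : 'I_(2 * m) :=
  rev_ord (swap i).

Lemma swap_revK (m : nat) : involutive (@swap_rev m).
Proof.
move=> i; apply: val_inj => /=; have := ltn_ord i.
by case: (boolP (odd i)) => i_odd; case: ifP; lia.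
Qed.

Lemma swap_rev_lt (m : nat) (i : 'I_(2 * m)) :
  ~~ odd m -> (swap_rev i < m)%N = ~~ (i < m)%N.
Proof. by move=> m_even; have := ltn_ord i; rewrite /=; case: ifP; lia. Qed.

Variables (m : nat) (k : int) (E : 'I_(2 * m) -> int) (J : 'I_(2 * m) -> bool).
Hypothesis S : Z_spectral_system k E J.

Lemma sum_spectral : \sum_(i | J i) E i = 1.
Proof.
pose s := -1 :: [seq E i | i <- enum J].
have sP y : reflect (spectral_set E J y) (y \in s).
  rewrite inE; apply: (iffP orP) => [[/eqP->|/mapP[i iJ ->]]|[->|[i iJ ->]]].
  - by left.
  - by right; exists i => //; rewrite mem_enum in iJ.
  - by left.
  - by right; apply: map_f; rewrite mem_enum.
have s_uniq : uniq s.
  rewrite /= map_inj_uniq ?enum_uniq ?andbT; last exact: zss_E_inj S.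
  by apply/mapP => -[i _ /esym]; apply: (zss_E_neqN1 S).
have /(sum_symmetric_seq s_uniq) : forall y, y \in s -> - y \in s.
  by move=> y /sP/(zss_d S)/sP.
by rewrite big_cons big_map big_enum /= => /eqP; rewrite addrC subr_eq0 => /eqP.
Qed.

Lemma rev_spec (i : 'I_(2 * m)) :
  J (rev_ord i) = ~~ J i /\ E (rev_ord i) = -1 - E i.
Proof.
have idx_rev : (idx i + idx (rev_ord i) = 2 * m + 1)%N.
  by rewrite /idx /=; have := ltn_ord i; lia.
have [<- J_neq] := zss_b S idx_rev; split; last by ring.
by case: (J i) J_neq; case: (J _).
Qed.

Lemma swap_spec (i : 'I_(2 * m)) :
  J (swap i) = ~~ J i /\ E (swap i) = if odd i then E i + k else E i - k.
Proof.
case: (boolP (odd i)) => i_odd.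
  have idx_i : idx i = (idx (swap i) + 1)%N by rewrite /idx /= i_odd; lia.
  have [|<- J_neq] := zss_c S idx_i; first by rewrite /= i_odd.
  by split; [case: (J i) J_neq; case: (J _) | ring].
have idx_swap : idx (swap i) = (idx i + 1)%N.
  by rewrite /idx /= (negbTE i_odd); lia.
have [|<- J_neq] := zss_c S idx_swap; first by rewrite idx_swap addn1 /= i_odd.
by split; [case: (J i) J_neq; case: (J _) | ring].
Qed.

Lemma J_swap_rev (i : 'I_(2 * m)) : J (swap_rev i) = J i.
Proof. by rewrite (rev_spec _).1 (swap_spec i).1 negbK. Qed.

(** The sum is [- 1 - k] or [- 1 + k], and [k = 2 e - 1] by (a), with [e] the
    first value of [E]. *)
Lemma E_swap_rev_even (i : 'I_(2 * m)) :
  exists h : int, E i + E (swap_rev i) = 2 * h.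
Proof.
have m_gt0 : (0 < 2 * m)%N by have := zss_m_ge2 S; lia.
have k_odd := zss_a S (erefl : idx (Ordinal m_gt0) = 1%N).
rewrite (rev_spec _).2 (swap_spec i).2; set e := E (Ordinal m_gt0) in k_odd.
by case: (odd i); [exists (- e) | exists (e - 1)]; lia.
Qed.

(** The part of the sum over the upper half of the indices is transported by
    [swap_rev] to the lower half, where it pairs off with the other part. *)
Lemma sum_even_of_even : ~~ odd m -> exists h : int, \sum_(i | J i) E i = 2 * h.
Proof.
move=> m_even.
rewrite (bigID (fun i : 'I__ => (i < m)%N)) /=.
rewrite [X in _ + X](reindex_inj (inv_inj (@swap_revK m))) /=.
rewrite [X in _ + X](eq_bigl (fun i => J i && (i < m)%N)); last first.
  by move=> i; rewrite J_swap_rev [X in ~~ X]swap_rev_lt // negbK.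
rewrite -big_split /=.
elim/big_rec: _ => [|i x _ [h ->]]; first by exists 0; rewrite mulr0.
by have [g ->] := E_swap_rev_even i; exists (g + h); rewrite mulrDr.
Qed.

End Spectral.

Theorem mainTheorem5 (m : nat) (k : int) (E : 'I_(2 * m) -> int)
    (J : 'I_(2 * m) -> bool) (S : Z_spectral_system k E J) : odd m.
Proof.
case: (boolP (odd m)) => // /(sum_even_of_even S)[h].
by rewrite (sum_spectral S); lia.
Qed.
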